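(* Let $n\ge 2$ and let $p(z)=z^n+a_1z^{n-1}+\cdots+a_{n-1}z+a_n$ be a complex polynomial of degree $n$ with zeros $z_1,\dots,z_n$ and critical points $w_1,\dots,w_{n-1}$. Assume $\sum_{j=1}^n z_j=0$. Then for every real $p\ge 2$, \[ \sum_{k=1}^{n-1}|w_k|^p\le \frac{n-2}{n}\sum_{j=1}^n|z_j|^p . \]
   Context: Zeros are listed with multiplicity. The critical points $w_1,\dots,w_{n-1}$ are the zeros of the derivative $p'(z)$, listed with multiplicity. *)

(* Defs.v *)
From HB Require Import structures.
From mathcomp Require Import all_boot all_order all_algebra.
From mathcomp Require Import complex.
From mathcomp Require Import all_classical all_reals all_analysis.
Set Implicit Arguments. Unset Strict Implicit. Unset Printing Implicit Defensive.
Import Order.TTheory GRing.Theory Num.Theory.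

(* Main.v *)
Require Import Defs.
From HB Require Import structures.
From mathcomp Require Import all_boot all_order all_algebra.
From mathcomp Require Import complex.
From mathcomp Require Import all_classical all_reals all_analysis.
From mathcomp Require Import measurable_realfun ring lra.
Import Order.TTheory GRing.Theory Num.Theory.
Local Open Scope ring_scope.

(* Let D be the diagonal matrix of the zeros and P the orthogonal projection
   onto the vectors with coordinate sum 0. The characteristic polynomial of
   M = PDP is (1/n) X p'(X), so the w_k and 0 are the eigenvalues of M. Put
   q = p/2 and x_j = |z_j|^2.

   If q >= 2, write a_k for the eigenvalues of M adj(M) and f_k for an
   orthonormal eigenbasis. By Weyl's inequality sum |w_k|^(2q) <= sum a_k^q,
   and Jensen's inequality gives a_k^q <= a_k sum_j |f_kj|^2 x_j^(q-1). As
   the sum of the z_j is 0, (M adj(M))_jj = (1 - 3/n) x_j + (1/n^2) sum_i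
   x_i, and Chebyshev's sum inequality finishes the proof.

   If 1 < q < 2, then t^q is, up to a constant factor, the integral of t^2/(t +
   l) against l^(q-2) dl over l > 0, so it suffices to treat the functions
   t^2/(t + l). For an orthonormal Schur basis u_k of M that also
   diagonalizes P, |w_k|^2 <= b_k := |u_k M|^2, and 1/(b_k + l) is bounded
   by the Cauchy-Schwarz inequality applied with the inverse, explicit by
   Sherman-Morrison, of l + D P adj(D); taking traces gives the claim. For q
   = 1 the Frobenius norm of M suffices. *)

(** * Characteristic polynomial of the compression PDP *)

(** The block [B] of [G] is cleared once by a column operation and once by a row operation; scaling
    the latter by [s] avoids any division. *)
Lemma det_scalar_sub_mulmxC (R : comNzRingType) (m n : nat) (s : R)
    (A : 'M[R]_(m, n)) (B : 'M[R]_(n, m)) :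
  s ^+ n * \det (s%:M - A *m B) = s ^+ m * \det (s%:M - B *m A).
Proof.
pose G := block_mx s%:M A B 1%:M.
have <- : \det (G *m block_mx 1%:M 0 (- B) 1%:M) = \det (s%:M - A *m B).
  rewrite mulmx_block !mulmx1 !mulmx0 !add0r !mulmxN mul1mx subrr.
  by rewrite det_ublock det1 mulr1.
have <- : \det (block_mx 1%:M 0 (- B) s%:M *m G) =
    s ^+ m * \det (s%:M - B *m A).
  rewrite mulmx_block !mul1mx !mul0mx !addr0 !mulNmx mulmx1 mul_mx_scalar.
  by rewrite mul_scalar_mx addNr det_ublock det_scalar (addrC (- _)).
by rewrite !det_mulmx !det_lblock !det1 det_scalar !mulr1 mul1r mulrC.
Qed.

Lemma char_poly_mulmxC (F : idomainType) (n : nat) (A B : 'M[F]_n) :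
  char_poly (A *m B) = char_poly (B *m A).
Proof.
have E (M N : 'M[F]_n) : char_poly (M *m N) =
    \det ('X%:M - map_mx polyC M *m map_mx polyC N).
  by rewrite /char_poly /char_poly_mx map_mxM.
have X0 : 'X^n != 0 :> {poly F} by rewrite -size_poly_eq0 size_polyXn.
by apply: (mulfI X0); rewrite !E det_scalar_sub_mulmxC.
Qed.

(** Multiplying on the right by the diagonal [B] of complementary products turns the diagonal part
    into the scalar [D]. Sylvester's identity then leaves a 1 x 1 determinant, and the nonzero
    factor [D * \det B] is cancelled. *)
Lemma det_diag_add_rank1 (F : idomainType) (n : nat) (d a : 'I_n -> F) :
  (forall i, d i != 0) ->
  \det (\matrix_(i, j) (d i *+ (i == j) + a i)) =
  \prod_i d i + \sum_i a i * \prod_(j | j != i) d j.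
Proof.
move=> d0; case: n d a d0 => [|n] d a d0.
  by rewrite det_mx00 !big_ord0 addr0.
set M := \matrix_(i, j) _; pose D := \prod_i d i.
have D0 : D != 0 by apply/prodf_neq0 => i _.
pose b i := \prod_(j | j != i) d j.
have db i : d i * b i = D by rewrite /D (bigD1 i).
pose B := diag_mx (\row_i b i).
have ME : M *m B = D%:M - (\col_i a i) *m (- \row_i b i).
  apply/matrixP => i j; rewrite mul_mx_diag !mxE big_ord1 !mxE mulrN opprK.
  rewrite mulrDl mulrnAl; congr (_ + _).
  by case: eqP => [->|_]; rewrite ?mulr1n ?mulr0n ?db // mul0r.
have detB : D * \det B = D * D ^+ n.
  rewrite -exprS det_diag /D -big_split /=.
  under eq_bigr do rewrite mxE db.
  by rewrite prodr_const card_ord.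
have := @det_scalar_sub_mulmxC F _ _ D (\col_i a i) (- \row_i b i).
rewrite -ME det_mulmx expr1 exprS -detB (mulrC (\det M)) mulrA.
have DB0 : D * \det B != 0 by rewrite detB -exprS expf_neq0.
move/(mulfI DB0) => ->; rewrite det_mx11 !mxE eqxx mulr1n; congr (_ + _).
rewrite -sumrN; apply: eq_bigr => i _.
by rewrite !mxE mulNr opprK mulrC.
Qed.

Lemma deriv_prod_XsubC (F : comNzRingType) (n : nat) (z : 'I_n -> F) :
  (\prod_j ('X - (z j)%:P))^`() =
  \sum_i \prod_(j | j != i) ('X - (z j)%:P).
Proof.
elim: n z => [|n IH] z; first by rewrite !big_ord0 -[1]/(1%:P) derivC.
rewrite [X in X^`()]big_ord_recl derivM derivXsubC mul1r IH big_ord_recl.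
congr (_ + _).
  rewrite [in RHS]big_mkcond big_ord_recl eqxx /= mul1r.
  exact: eq_bigr.
rewrite mulr_sumr; apply: eq_bigr => i _.
rewrite [in RHS]big_mkcond big_ord_recl /=; congr (_ * _).
by rewrite big_mkcond; apply: eq_bigr => j _; rewrite (inj_eq lift_inj).
Qed.

Definition centering (F : fieldType) (n : nat) : 'M[F]_n :=
  1%:M - const_mx n%:R^-1.

Definition compression (F : fieldType) (n : nat) (z : 'I_n -> F) : 'M[F]_n :=
  centering F n *m diag_mx (\row_j z j) *m centering F n.

Lemma centering_idem (F : numFieldType) (n : nat) :
  centering F n *m centering F n = centering F n.
Proof.
case: n => [|n]; first by apply/matrixP => - [].
rewrite /centering mulmxBl mul1mx mulmxBr mulmx1.
set J := const_mx _; have -> : J *m J = J.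
  apply/matrixP => i j; rewrite !mxE.
  under eq_bigr do rewrite !mxE.
  rewrite sumr_const card_ord -[_ *+ _]mulr_natl mulrA divff ?mul1r //.
by rewrite subrr subr0.
Qed.

(** Cyclicity and P^2 = P replace PDP by DP, and X - DP is diagonal plus rank one. In the resulting
    sum the factors X - z_i and z_i add up to X, leaving the Leibniz expansion of p'. *)
Lemma char_poly_compression (F : numFieldType) (n : nat) (z : 'I_n -> F) :
  (0 < n)%N ->
  n%:R *: char_poly (compression F n z) =
  'X * (\prod_j ('X - (z j)%:P))^`().
Proof.
move=> n0; have nF : n%:R != 0 :> F by rewrite pnatr_eq0 -lt0n.
rewrite /compression -mulmxA char_poly_mulmxC -mulmxA centering_idem.
have -> : char_poly (diag_mx (\row_j z j) *m centering F n) =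
    \det (\matrix_(i, j) (('X - (z i)%:P) *+ (i == j) + (z i / n%:R)%:P)).
  congr (\det _); apply/matrixP => i j.
  rewrite mul_diag_mx !mxE mulrBr polyCB opprB addrA addrAC; congr (_ + _).
  by case: eqP => [->|_]; rewrite ?mulr1n ?mulr1 // !mulr0n mulr0 polyC0 subr0.
rewrite det_diag_add_rank1; last by move=> i; rewrite polyXsubC_eq0.
rewrite deriv_prod_XsubC mulr_sumr scalerDr scaler_sumr.
have -> : n%:R *: \prod_j ('X - (z j)%:P) =
    \sum_i ('X - (z i)%:P) * \prod_(j | j != i) ('X - (z j)%:P).
  rewrite scaler_nat -[X in _ *+ X]card_ord -sumr_const.
  by apply: eq_bigr => i _; rewrite [LHS](bigD1 i).
rewrite -big_split /=; apply: eq_bigr => i _.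
rewrite scalerAl -mul_polyC -polyCM (mulrC n%:R) divfK //.
by rewrite -mulrDl subrK.
Qed.

(** * Jensen's inequality for real powers *)

Lemma jensen_powR (R : realType) (I : finType) (w a : I -> R) (q : R) :
  1 <= q -> (forall i, 0 <= w i) -> (forall i, 0 <= a i) ->
  \sum_i w i = 1 ->
  (\sum_i w i * a i) `^ q <= \sum_i w i * a i `^ q.
Proof.
move=> q1 w0 a0 w1; set m := \sum_i w i * a i.
have m0 : 0 <= m by apply: sumr_ge0 => i _; rewrite mulr_ge0.
move: q1; rewrite le_eqVlt => /predU1P[<-|q1].
  rewrite powRr1 // le_eqVlt; apply/orP; left; apply/eqP/eq_bigr => i _.
  by rewrite powRr1.
have q0 : 0 < q by rewrite (lt_trans _ q1).
have qB0 : 0 < q - 1 by rewrite subr_gt0.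
have tangent i : q * a i * m `^ (q - 1) - (q - 1) * m `^ q <= a i `^ q.
  pose p := q / (q - 1).
  have p0 : 0 < p by rewrite divr_gt0.
  have pq : q^-1 + p^-1 = 1 by rewrite /p; field; rewrite !gt_eqF.
  have := conjugate_powR (a0 i) (powR_ge0 m (q - 1)) q0 p0 pq.
  rewrite -powRrM (_ : (q - 1) * p = q); last first.
    by rewrite /p; field; rewrite gt_eqF.
  rewrite -(ler_pM2l q0) => h; rewrite lerBlDr -mulrA; apply: le_trans h _.
  rewrite le_eqVlt; apply/orP; left; apply/eqP.
  by rewrite /p; field; rewrite !gt_eqF.
apply: le_trans (ler_sum _ (fun i _ => ler_wpM2l (w0 i) (tangent i))).
have -> : \sum_i w i * (q * a i * m `^ (q - 1) - (q - 1) * m `^ q) =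
    q * m `^ (q - 1) * (\sum_i w i * a i) -
    (q - 1) * m `^ q * (\sum_i w i).
  by rewrite !mulr_sumr -sumrB; apply: eq_bigr => i _; ring.
rewrite -/m w1 mulr1 -mulrA (mulrC _ m) mulr_powRB1 //.
rewrite le_eqVlt; apply/orP; left; apply/eqP; ring.
Qed.

(** * Integral representation of t^q for 1 < q < 2 *)

Section StieltjesKernel.
Import numFieldNormedType.Exports.
Local Open Scope classical_set_scope.
Context {R : realType}.
Variable q : R.
Hypothesis q_itv : 1 < q < 2.
Local Notation mu := (@lebesgue_measure R).

(* The substitution l = e^v turns scaling of t into translation of v. *)
Let kern (t v : R) : R := t ^+ 2 * expR ((q - 1) * v) / (t + expR v).

Let q1 : 0 < q - 1. Proof. by rewrite subr_gt0; case/andP: q_itv. Qed.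
Let q2 : 0 < 2 - q. Proof. by rewrite subr_gt0; case/andP: q_itv. Qed.

Let den_gt0 (t v : R) : 0 <= t -> 0 < t + expR v.
Proof. by move=> t0; rewrite ltr_wpDl ?expR_gt0. Qed.

Let kern_ge0 (t v : R) : 0 <= t -> 0 <= kern t v.
Proof.
move=> t0; rewrite /kern divr_ge0 ?mulr_ge0 ?expR_ge0 ?sqr_ge0 //.
exact/ltW/den_gt0.
Qed.

Let kern_continuous (t : R) : 0 <= t -> continuous (kern t).
Proof.
move=> t0 v.
apply: (@continuousM _ R^o (fun v => t ^+ 2 * expR ((q - 1) * v))
  (fun v => (t + expR v)^-1)).
  apply: (@continuousM _ R^o (fun=> t ^+ 2) (fun v => expR ((q - 1) * v))).
    exact: cst_continuous.
  apply: continuous_comp; last exact: continuous_expR.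
  by apply: continuousM => //; exact: cst_continuous.
apply: (@continuousV _ R^o); first by rewrite gt_eqF // den_gt0.
by apply: continuousD; [exact: cst_continuous | exact: continuous_expR].
Qed.

Let kern_measurable (D : set R) (t : R) : 0 <= t ->
  measurable_fun D (fun v => (kern t v)%:E).
Proof.
move=> t0; apply/measurable_EFinP; apply: measurable_funTS.
by apply: continuous_measurable_fun; exact: kern_continuous.
Qed.

Let kern_shift (t u : R) : 0 < t -> kern t (u + ln t) = t `^ q * kern 1 u.
Proof.
move=> t0; have u0 : 0 < 1 + expR u by apply: den_gt0.
rewrite /kern expRD lnK ?posrE // mulrDr expRD expr1n mul1r.
rewrite [expR (_ * ln t)](_ : _ = t `^ (q - 1)); last first.
  by rewrite /powR gt_eqF.
rewrite -(mulr_powRB1 (ltW t0) (lt_trans ltr01 (andP q_itv).1)).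
have -> : t + expR u * t = t * (1 + expR u) by rewrite mulrDr mulr1 mulrC.
by field; rewrite !gt_eqF.
Qed.

Let kern_integral (t : R) : 0 <= t ->
  (\int[mu]_v (kern t v)%:E = (t `^ q)%:E * \int[mu]_v (kern 1 v)%:E)%E.
Proof.
(* The shift by [ln t] needs t > 0; at t = 0 both sides vanish. *)
rewrite le_eqVlt => /predU1P[<-|t0].
  rewrite powR0; last by rewrite gt_eqF // (lt_trans ltr01) ?(andP q_itv).1.
  rewrite mul0e integral0_eq // => v _.
  by rewrite /kern expr0n !mul0r.
have dF : (fun u : R => u + ln t)^`() = cst 1.
  apply/funext => u; rewrite derive1E.
  by rewrite deriveD // derive_id derive_cst addr0.
rewrite (@increasing_ge0_integration_by_substitutionT R (fun u => u + ln t)).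
- transitivity (\int[mu]_v ((t `^ q)%:E * (kern 1 v)%:E))%E.
    apply: eq_integral => v _.
    by rewrite dF -EFinM -kern_shift // -[in RHS](mulr1 (kern _ _)).
  rewrite ge0_integralZl_EFin ?powR_ge0 //.
    by move=> v _; rewrite lee_fin kern_ge0.
  exact (kern_measurable _ _ ler01).
- by move=> x y xy; rewrite ltrD2r.
- by rewrite dF => x; exact: cst_continuous.
- by rewrite dF; exact: is_cvg_cst.
- by rewrite dF; exact: is_cvg_cst.
- by move=> x.
- exact: cvg_addrr_Ny.
- exact: cvg_addrr.
- exact/kern_continuous/ltW.
- by move=> v; exact/kern_ge0/ltW.
Qed.

(** On [0, 1] the kernel is at least 1/(1 + e). *)
Let kern1_gt0 : (0 < \int[mu]_v (kern 1 v)%:E)%E.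
Proof.
have c0 : 0 < (1 + expR 1)^-1 :> R by rewrite invr_gt0 den_gt0.
apply: (@lt_le_trans _ _ (\int[mu]_(v in `[0%R, 1%R]) (kern 1 v)%:E)%E).
  apply: (@lt_le_trans _ _ (\int[mu]_(v in `[0%R, 1%R]) ((1 + expR 1)^-1)%:E)%E).
    rewrite integral_cst //= lebesgue_measure_itv /= lte_fin ltr01 oppr0 adde0.
    by rewrite mule1 lte_fin.
  apply: ge0_le_integral => //.
  - exact (kern_measurable _ _ ler01).
  - move=> v /=; rewrite in_itv /= => /andP[v0 v1].
    rewrite lee_fin /kern expr1n mul1r -[leLHS]mul1r; apply: ler_pM => //.
    - by rewrite -[leLHS]expR0 ler_expR; exact: mulr_ge0 (ltW q1) v0.
    - by rewrite lef_pV2 ?posrE ?den_gt0 // lerD2l ler_expR.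
apply: ge0_subset_integral => //; first exact (kern_measurable _ _ ler01).
by move=> v _; rewrite lee_fin kern_ge0.
Qed.

Let kern1_lty : (\int[mu]_v (kern 1 v)%:E < +oo)%E.
Proof.
pose r := Num.min (q - 1) (2 - q).
have r0 : 0 < r by rewrite lt_min q1 q2.
pose f (v : R) := expR (- r * `|v|).
have cf : continuous f.
  move=> v; apply: continuous_comp; last exact: continuous_expR.
  apply: continuousM; first exact: cst_continuous.
  exact: (@norm_continuous _ R^o).
have mf : measurable_fun setT (EFin \o f).
  by apply/measurable_EFinP; exact: continuous_measurable_fun.
apply: (@le_lt_trans _ _ (\int[mu]_v (f v)%:E)%E).
  apply: ge0_le_integral => //.
  - by move=> v _; rewrite lee_fin kern_ge0.
  - exact (kern_measurable _ _ ler01).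
  - move=> v _; rewrite lee_fin /kern expr1n mul1r ler_pdivrMr ?den_gt0 //.
    rewrite /f; case: (lerP 0 v) => v0.
      rewrite ger0_norm //; apply: (@le_trans _ _ (expR (- r * v) * expR v)).
        rewrite -expRD ler_expR.
        have : r <= 2 - q by rewrite ge_min lexx orbT.
        move/(ler_wpM2r v0); lra.
      by rewrite ler_wpM2l ?expR_ge0 // lerDr.
    rewrite ltr0_norm //; apply: (@le_trans _ _ (expR (- r * - v))).
      rewrite ler_expR mulrNN.
      have : r <= q - 1 by rewrite ge_min lexx.
      by move/(ler_wnM2r (ltW v0)).
    by rewrite ler_peMr ?expR_ge0 // lerDl expR_ge0.
(* By symmetry only the half-line matters, where [f] is 1/r times the exponential density of rate
   [r]. *)
rewrite ge0_symfun_integralT //; last 2 first.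
  by move=> v; rewrite expR_ge0.
  by move=> v; rewrite /f /= normrN.
have E : (\int[mu]_(v in [set x | (0 <= x)%R]) (f v)%:E =
    \int[mu]_(v in [set x | (0 <= x)%R])
      ((r^-1)%:E * (exponential_pdf r v)%:E))%E.
  apply: eq_integral => v; rewrite inE /= => v0.
  rewrite exponential_pdfE // /f ger0_norm // -EFinM mulrA mulVf ?mul1r //.
  by rewrite gt_eqF.
have mE (D : set R) : measurable_fun D (fun v => (exponential_pdf r v)%:E).
  apply/measurable_EFinP; apply: measurable_funTS.
  exact: measurable_exponential_pdf.
have pdf0 (v : R) : (0 <= (exponential_pdf r v)%:E)%E.
  by rewrite lee_fin exponential_pdf_ge0 // ltW.
have m0 : measurable [set x : R | 0 <= x].
  rewrite (_ : [set x | _] = `[0, +oo[%classic) //.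
  by apply/seteqP; split => x /=; rewrite in_itv /= andbT.
rewrite E ge0_integralZl_EFin //; last 2 first.
  exact (mE _).
  by rewrite invr_ge0 ltW.
have I1 : (\int[mu]_(v in [set x | (0 <= x)%R]) (exponential_pdf r v)%:E
    <= 1)%E.
  rewrite -(integral_exponential_pdf r0); apply: ge0_subset_integral => //.
  exact (mE _).
rewrite lte_mul_pinfty // lte_mul_pinfty ?lee_fin ?invr_ge0 ?(ltW r0) //.
exact: le_lt_trans I1 (ltry _).
Qed.

(** The hypothesis at l = e^v is integrated against e^((q-1)v) dv. Each side becomes its power sum
    times the same constant [K], which is positive and finite and so cancels. *)
Lemma ler_sum_powR_of_resolvent (I J : finType) (a : I -> R) (x : J -> R)
    (c : R) :
  0 <= c -> (forall i, 0 <= a i) -> (forall j, 0 <= x j) ->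
  (forall l, 0 < l ->
    \sum_i a i ^+ 2 / (a i + l) <= c * \sum_j x j ^+ 2 / (x j + l)) ->
  \sum_i a i `^ q <= c * \sum_j x j `^ q.
Proof.
move=> c0 a0 x0 H; set K := (\int[mu]_v (kern 1 v)%:E)%E.
have Kfin : K \is a fin_num by rewrite ge0_fin_numE ?kern1_lty // ltW ?kern1_gt0.
have sumE (T : finType) (y : T -> R) : (forall i, 0 <= y i) ->
    (\int[mu]_v (\sum_i kern (y i) v)%:E)%E = ((\sum_i y i `^ q)%:E * K)%E.
  move=> y0; under eq_integral do rewrite -sumEFin.
  rewrite ge0_integral_sum //; last 2 first.
    move=> i; exact (kern_measurable _ _ (y0 i)).
    by move=> i v _; rewrite lee_fin kern_ge0.
  rewrite -sumEFin ge0_sume_distrl; last by move=> i _; rewrite lee_fin powR_ge0.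
  by apply: eq_bigr => i _; rewrite kern_integral.
have K0 : 0 < fine K by rewrite fine_gt0 // kern1_gt0 kern1_lty.
have mS (T : finType) (y : T -> R) : (forall i, 0 <= y i) ->
    measurable_fun [set: R] (fun v => (\sum_i kern (y i) v)%:E).
  move=> y0; apply/measurable_EFinP; apply: measurable_sum => i.
  by apply: continuous_measurable_fun; exact: kern_continuous.
have S0 (T : finType) (y : T -> R) v : (forall i, 0 <= y i) ->
    (0 <= (\sum_i kern (y i) v)%:E)%E.
  by move=> y0; rewrite lee_fin sumr_ge0 // => i _; exact: kern_ge0.
rewrite -(ler_pM2r K0) -lee_fin EFinM fineK // -sumE // -mulrA EFinM EFinM.
rewrite fineK // -sumE // -ge0_integralZl_EFin //; last 2 first.
- by move=> v _; exact: S0.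
- exact (mS _ _ x0).
apply: ge0_le_integral => //.
- by move=> v _; exact: S0.
- exact (mS _ _ a0).
- by under eq_fun do rewrite -EFinM; apply/measurable_EFinP;
    apply: measurable_funM => //; apply/measurable_EFinP; exact (mS _ _ x0).
move=> v _; rewrite -EFinM lee_fin.
have E (t : R) : kern t v = expR ((q - 1) * v) * (t ^+ 2 / (t + expR v)).
  by rewrite /kern mulrCA mulrA mulrAC.
under eq_bigr do rewrite E.
under [in leRHS]eq_bigr do rewrite E.
by rewrite -!mulr_sumr mulrCA ler_wpM2l ?expR_ge0 // H // expR_gt0.
Qed.

End StieltjesKernel.

(** * Sum inequalities and the squared modulus *)

(** Lagrange's identity: twice the deficit is a double sum of squares. *)
Lemma real_cauchy_schwarz (F : realDomainType) (I : finType) (a b : I -> F) :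
  (\sum_i a i * b i) ^+ 2 <= (\sum_i a i ^+ 2) * (\sum_i b i ^+ 2).
Proof.
rewrite -subr_ge0 -(pmulrn_lge0 _ (ltn0Sn 1)).
have -> : ((\sum_i a i ^+ 2) * (\sum_i b i ^+ 2)
    - (\sum_i a i * b i) ^+ 2) *+ 2 =
    \sum_i \sum_j (a i * b j - a j * b i) ^+ 2.
  rewrite mulrnBl mulr2n [in X in _ - X]mulr2n.
  rewrite {2}(mulrC (\sum_i a i ^+ 2)) expr2 !big_distrlr /=.
  rewrite -!big_split /= -sumrB; apply: eq_bigr => i _.
  rewrite -!big_split /= -sumrB; apply: eq_bigr => j _.
  by ring.
by apply: sumr_ge0 => i _; apply: sumr_ge0 => j _; exact: sqr_ge0.
Qed.

(** Twice the deficit is the double sum of the products assumed nonnegative. *)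
Lemma chebyshev_sum (F : realFieldType) (n : nat) (a b : 'I_n -> F) :
  (forall i j, 0 <= (a i - a j) * (b i - b j)) ->
  (\sum_i a i) * (\sum_i b i) <= n%:R * \sum_i a i * b i.
Proof.
move=> ab; rewrite -subr_ge0 -(pmulrn_lge0 _ (ltn0Sn 1)).
have -> : (n%:R * (\sum_i a i * b i) - (\sum_i a i) * (\sum_i b i)) *+ 2 =
    \sum_i \sum_j (a i - a j) * (b i - b j).
  have E : n%:R * (\sum_i a i * b i) = \sum_(i < n) \sum_(j < n) a j * b j.
    by rewrite sumr_const card_ord mulr_natl.
  rewrite mulrnBl mulr2n [in X in _ - X]mulr2n {1}E exchange_big E.
  rewrite {2}(mulrC (\sum_i a i)) !big_distrlr /=.
  rewrite -!big_split /= -sumrB; apply: eq_bigr => i _.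
  rewrite -!big_split /= -sumrB; apply: eq_bigr => j _.
  by ring.
by apply: sumr_ge0 => i _; apply: sumr_ge0.
Qed.

(* Locked so that [rmorphM] does not see the square inside. *)
HB.lock Definition sqnorm {R : realType} (z : R[i]) : R :=
  ComplexField.Normc.normc z ^+ 2.

Section SquaredModulus.
Context {R : realType}.
Local Notation C := R[i].

Lemma sqnorm_ge0 (z : C) : 0 <= sqnorm z.
Proof. by rewrite sqnorm.unlock sqr_ge0. Qed.

Lemma sqnormE (z : C) : real_complex R (sqnorm z) = z * z^*.
Proof. by rewrite sqnorm.unlock -normCK rmorphXn. Qed.

Lemma sqnorm0 : sqnorm (0 : C) = 0.
Proof. by apply: complexI; rewrite sqnormE mul0r. Qed.

Lemma sqnormM (x y : C) : sqnorm (x * y) = sqnorm x * sqnorm y.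
Proof. by rewrite sqnorm.unlock ComplexField.Normc.normcM exprMn. Qed.

Lemma sqnormC (x : C) : sqnorm x^* = sqnorm x.
Proof. by apply: complexI; rewrite !sqnormE conjCK mulrC. Qed.

Lemma sqnorm_real (r : R) : sqnorm (real_complex R r) = r ^+ 2.
Proof.
apply: complexI; rewrite sqnormE rmorphXn expr2; congr (_ * _).
by apply/CrealP; apply/complex_realP; exists r.
Qed.

Lemma sqnorm_cauchy_schwarz (I : finType) (a b : I -> C) :
  sqnorm (\sum_i a i * b i) <= (\sum_i sqnorm (a i)) * (\sum_i sqnorm (b i)).
Proof.
pose nc := @ComplexField.Normc.normc R.
have nc0 x : 0 <= nc x by case: x => u v; exact: sqrtr_ge0.
rewrite sqnorm.unlock.
apply: le_trans (real_cauchy_schwarz _ _ (nc \o a) (nc \o b)).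
rewrite lerXn2r ?nnegrE ?nc0 //.
  by apply: sumr_ge0 => i _; rewrite mulr_ge0 ?nc0.
elim/big_ind2: _ => [|x1 x2 y1 y2 h1 h2|i _].
- by rewrite ComplexField.Normc.normc0.
- exact: le_trans (le_normcD _ _) (lerD h1 h2).
- by rewrite ComplexField.Normc.normcM.
Qed.

Lemma sum_sqnorm_unitary (n : nat) (U : 'M[C]_n) (g : 'I_n -> C) :
  U \is unitarymx ->
  \sum_k sqnorm (\sum_j U k j * g j) = \sum_j sqnorm (g j).
Proof.
move=> /unitarymxP/mulmx1C UU; pose G : 'cV_n := \col_j g j.
have nrm (v : 'cV[C]_n) :
    real_complex R (\sum_k sqnorm (v k 0)) = (map_mx Num.conj v^T *m v) 0 0.
  rewrite rmorph_sum mxE /=; apply: eq_bigr => k _.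
  by rewrite sqnormE !mxE mulrC.
apply: complexI; transitivity (real_complex R (\sum_k sqnorm ((U *m G) k 0))).
  congr (real_complex R _); apply: eq_bigr => k _; rewrite mxE.
  by congr sqnorm; apply: eq_bigr => j _; rewrite mxE.
rewrite nrm trmx_mul map_mxM mulmxA -(mulmxA _ _ U) UU mulmx1 -nrm.
by congr (real_complex R _); apply: eq_bigr => j _; rewrite mxE.
Qed.

Lemma row_sqnorm_unitary (n : nat) (U : 'M[C]_n) k :
  U \is unitarymx -> \sum_j sqnorm (U k j) = 1.
Proof.
move=> /unitarymxP/matrixP/(_ k k); rewrite !mxE eqxx => E.
apply: complexI; rewrite rmorph_sum /= rmorph1 -[RHS]E.
by apply: eq_bigr => j _; rewrite sqnormE !mxE.
Qed.

Lemma sum_sqnorm_unitary_mul (n : nat) (U M : 'M[C]_n) l :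
  U \is unitarymx ->
  \sum_k sqnorm ((U *m M) k l) = \sum_j sqnorm (M j l).
Proof.
move=> Uu; rewrite -(sum_sqnorm_unitary _ _ (fun j => M j l) Uu).
by apply: eq_bigr => k _; rewrite mxE.
Qed.

End SquaredModulus.

(** * Cauchy-Schwarz bound for the resolvent *)

Section Resolvent.
Context {R : realType}.
Local Notation C := R[i].
Local Notation toC := (real_complex R).

Let conj_real (r : R) : (toC r)^* = toC r.
Proof. by apply/CrealP; apply/complex_realP; exists r. Qed.

(** Pythagoras: a vector with sum 0 is orthogonal to the constant vectors. *)
Lemma sum_sqnorm_add_centered (n : nat) (a : C) (g : 'I_n -> C) :
  \sum_j g j = 0 ->
  \sum_j sqnorm (a + g j) = n%:R * sqnorm a + \sum_j sqnorm (g j).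
Proof.
move=> g0; apply: complexI.
rewrite rmorphD rmorphM rmorph_nat !rmorph_sum /= sqnormE.
transitivity (\sum_j (a * a^* + a * (g j)^* + a^* * g j + toC (sqnorm (g j)))).
  by apply: eq_bigr => j _; rewrite !sqnormE rmorphD /=; ring.
have gC0 : \sum_j (g j)^* = 0 by rewrite -rmorph_sum g0 rmorph0.
rewrite !big_split /= -!mulr_sumr g0 gC0 !mulr0 !addr0.
by rewrite sumr_const card_ord mulr_natl mulrnAr.
Qed.

Lemma sum_sqnorm_sub_mean (n : nat) (g : 'I_n -> C) : (0 < n)%N ->
  \sum_j sqnorm (g j - (\sum_k g k) / n%:R) <= \sum_j sqnorm (g j).
Proof.
move=> n0; set m := _ / _.
have nC : n%:R != 0 :> C by rewrite pnatr_eq0 -lt0n.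
have g0 : \sum_j (g j - m) = 0.
  by rewrite sumrB sumr_const card_ord -[m *+ n]mulr_natr divfK ?subrr.
have := sum_sqnorm_add_centered _ m _ g0.
under eq_bigr do rewrite addrC subrK.
by move=> ->; rewrite lerDr mulr_ge0 ?sqnorm_ge0.
Qed.

(** Pairing v with (l + adj(D) P D) al = v writes |v|^2 as an inner product of (sqrt l al, be) with
    (sqrt l v, Dv - c). The constant [c] is free because the entries of [be] sum to 0. The second
    factor of the bound is the squared norm of the first vector. *)
Lemma resolvent_cauchy_schwarz (n : nat) (z v : 'I_n -> C) (c : C) (l : R)
    (r := fun j => (l + sqnorm (z j))^-1) (S := \sum_j r j) :
  0 < l -> S != 0 ->
  (\sum_j sqnorm (v j)) ^+ 2 <=
  (l * \sum_j sqnorm (v j) + \sum_j sqnorm (v j * z j - c)) *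
  (\sum_j r j * sqnorm (v j) +
     sqnorm (\sum_j z j * toC (r j) * v j) / (l * S)).
Proof.
move=> l0 S0; set k := \sum_j z j * _ * _.
have den j : 0 < l + sqnorm (z j) by rewrite ltr_wpDr ?sqnorm_ge0.
have rE j : (l + sqnorm (z j)) * r j = 1 by rewrite mulfV // gt_eqF.
have lS : l * S != 0 by rewrite mulf_neq0 // gt_eqF.
(* [mu] is the mean of the z_j al_j, as given by Sherman-Morrison; the existential hides its value
   until it is needed. *)
have [mu muE] : exists mu, mu = k / toC (l * S) by eexists.
(* [al] solves (l + adj(D) P D) al = v, and [be] = P D al. *)
pose al j := toC (r j) * (v j + (z j)^* * mu).
pose be j := toC (r j) * (z j * v j - toC l * mu).
pose s := Num.sqrt l.
have ss : toC s * toC s = toC l by rewrite -rmorphM -expr2 sqr_sqrtr // ltW.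
pose f (i : 'I_n + 'I_n) : C :=
  match i with inl j => toC s * (al j)^* | inr j => (be j)^* end.
pose g (i : 'I_n + 'I_n) : C :=
  match i with inl j => toC s * v j | inr j => v j * z j - c end.
have sum_be : \sum_j be j = 0.
  transitivity (k - toC l * mu * toC S).
    rewrite /k /S rmorph_sum mulr_sumr -sumrB; apply: eq_bigr => j _.
    by rewrite /be; ring.
  rewrite muE mulrAC -rmorphM mulrC divfK ?subrr //.
  by rewrite -(rmorph0 toC) (inj_eq (@complexI R)).
have sum_fg : \sum_i f i * g i = toC (\sum_j sqnorm (v j)).
  rewrite big_sumType /= -big_split /=.
  transitivity (\sum_j (toC (sqnorm (v j)) - c * (be j)^*)).
    apply: eq_bigr => j _; rewrite -[toC (sqnorm _)]mul1r -(rmorph1 toC) -(rE j).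
    rewrite rmorphM rmorphD /= !sqnormE /al /be !(rmorphM, rmorphD, rmorphN) /=.
    rewrite !conj_real !conjCK !sqnormE mulrACA ss; ring.
  have beC0 : \sum_j (be j)^* = 0 by rewrite -rmorph_sum sum_be rmorph0.
  by rewrite sumrB -mulr_sumr beC0 mulr0 subr0 rmorph_sum.
(* The cross terms of the two squares cancel, and one factor [r j] is absorbed by
   [l + sqnorm (z j)]. *)
have key j : l * sqnorm (al j) + sqnorm (be j) =
    r j * (sqnorm (v j) + l * sqnorm mu).
  have -> : r j * (sqnorm (v j) + l * sqnorm mu) =
      r j * r j * (l + sqnorm (z j)) * (sqnorm (v j) + l * sqnorm mu).
    by rewrite -(mulrA (r j) (r j)) (mulrC (r j) (l + _)) rE mulr1.
  apply: complexI; rewrite rmorphD (rmorphM _ l) (rmorphM _ (r j * r j * _)).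
  rewrite (rmorphM _ (r j * r j)) (rmorphM _ (r j)) !rmorphD (rmorphM _ l) /=.
  rewrite !sqnormE /al /be !(rmorphM, rmorphD, rmorphN) /= !conj_real !conjCK.
  ring.
have sum_f : \sum_i sqnorm (f i) =
    \sum_j r j * sqnorm (v j) + sqnorm k / (l * S).
  rewrite big_sumType /= -big_split /=.
  transitivity (\sum_j (r j * sqnorm (v j) + r j * (l * sqnorm mu))).
    apply: eq_bigr => j _; rewrite sqnormM !sqnormC sqnorm_real sqr_sqrtr ?ltW //.
    by rewrite key mulrDr.
  rewrite big_split /= -mulr_suml -/S; congr (_ + _).
  have : sqnorm mu * (l * S) ^+ 2 = sqnorm k.
    rewrite muE -sqnorm_real -sqnormM divfK //.
    by rewrite -(rmorph0 toC) (inj_eq (@complexI R)).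
  by move=> <-; field; rewrite S0 gt_eqF.
have sum_g : \sum_i sqnorm (g i) =
    l * \sum_j sqnorm (v j) + \sum_j sqnorm (v j * z j - c).
  rewrite big_sumType /= mulr_sumr; congr (_ + _); apply: eq_bigr => j _.
  by rewrite sqnormM sqnorm_real sqr_sqrtr ?ltW.
by rewrite -sqnorm_real -sum_fg -sum_f -sum_g mulrC sqnorm_cauchy_schwarz.
Qed.

End Resolvent.

(** * Entries and norms of the compression M *)

Section Compression.
Context {R : realType}.
Local Notation C := R[i].
Local Notation toC := (real_complex R).
Variables (n : nat) (z : 'I_n -> C).
Hypothesis n_gt0 : (0 < n)%N.
Hypothesis z_sum0 : \sum_j z j = 0.
Local Notation P := (centering C n).
Local Notation M := (compression C n z).
Local Notation x := (fun j => sqnorm (z j)).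
Local Notation nR := (n%:R : R).

Let nC0 : n%:R != 0 :> C. Proof. by rewrite pnatr_eq0 -lt0n. Qed.
Let nR0 : 0 < nR. Proof. by rewrite ltr0n. Qed.

Let toC_nV : toC nR^-1 = n%:R^-1.
Proof. by rewrite fmorphV rmorph_nat. Qed.

Lemma mulmx_centeringE (m : nat) (A : 'M[C]_(m, n)) k j :
  (A *m P) k j = A k j - (\sum_l A k l) / n%:R.
Proof.
rewrite /centering mulmxBr mulmx1 !mxE; congr (_ - _).
by rewrite mulr_suml; apply: eq_bigr => l _; rewrite mxE.
Qed.

Lemma mulmx_compressionE (U : 'M[C]_n) k j (V := U *m P) :
  (U *m M) k j = V k j * z j - (\sum_l V k l * z l) / n%:R.
Proof.
rewrite /compression !mulmxA mulmx_centeringE -/V.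
have E l : (V *m diag_mx (\row_i z i)) k l = V k l * z l.
  by rewrite mul_mx_diag !mxE.
by rewrite E; under eq_bigr do rewrite E.
Qed.

(** With J the matrix of entries 1/n, the term JDJ of (1 - J)D(1 - J) vanishes because the z_j sum
    to 0. *)
Lemma compressionE i j : M i j = z i *+ (i == j) - (z i + z j) / n%:R.
Proof.
have PE k l : P k l = (k == l)%:R - n%:R^-1 by rewrite !mxE.
have P0 k : \sum_l P k l * z l = z k.
  under eq_bigr do rewrite PE mulrBl.
  rewrite sumrB -mulr_sumr z_sum0 mulr0 subr0 (bigD1 k) //= eqxx mul1r.
  by rewrite big1 ?addr0 // => l /negPf; rewrite eq_sym => ->; rewrite mul0r.
have -> : M = P *m diag_mx (\row_i z i) *m P by [].
rewrite mulmx_centeringE.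
have E k l : (P *m diag_mx (\row_i z i)) k l = P k l * z l.
  by rewrite mul_mx_diag !mxE.
rewrite E; under eq_bigr do rewrite E.
rewrite P0 PE; case: (eqVneq i j) => [<-|_] /=.
  by rewrite mulr1n; field.
by rewrite mulr0n; field.
Qed.

(** Off the diagonal the entries are [- u l], whose full square sum follows from Pythagoras. Only
    the diagonal entry, z_j (1 - 2/n) in place of -2 z_j/n, needs correction. *)
Lemma row_sqnorm_compression j :
  \sum_l sqnorm (M j l) = x j * (1 - 3 / nR) + (\sum_l x l) / nR ^+ 2.
Proof.
pose u l := (z j + z l) / n%:R.
have uE l : sqnorm (u l) = sqnorm (z j + z l) / nR ^+ 2.
  by rewrite /u sqnormM -toC_nV sqnorm_real exprVn.
have su : \sum_l sqnorm (u l) = x j / nR + (\sum_l x l) / nR ^+ 2.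
  under eq_bigr do rewrite uE.
  rewrite -mulr_suml (sum_sqnorm_add_centered _ _ _ z_sum0) mulrDl.
  by congr (_ + _); field; rewrite gt_eqF.
have ujj : u j = z j * toC (2 / nR).
  by rewrite rmorphM /= toC_nV rmorph_nat /u; field.
have -> : \sum_l sqnorm (M j l) =
    \sum_l sqnorm (u l) + (sqnorm (z j - u j) - sqnorm (u j)).
  rewrite (bigD1 j) //= [in RHS](bigD1 j) //= compressionE eqxx mulr1n -/(u j).
  rewrite (eq_bigr (fun l => sqnorm (u l))); first by ring.
  move=> l /negPf lj; rewrite compressionE eq_sym lj mulr0n sub0r -mulN1r.
  by rewrite sqnormM -(rmorphN1 toC) sqnorm_real sqrrN expr1n mul1r.
have -> : z j - u j = z j * toC (1 - 2 / nR).
  by rewrite ujj rmorphB rmorph1 mulrBr mulr1.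
by rewrite su ujj !sqnormM !sqnorm_real; field; rewrite gt_eqF.
Qed.

Lemma sum_sqnorm_compression :
  \sum_j \sum_l sqnorm (M j l) = (1 - 2 / nR) * \sum_j x j.
Proof.
under eq_bigr do rewrite row_sqnorm_compression.
rewrite big_split /= -mulr_suml sumr_const card_ord -mulr_natr.
by field; rewrite gt_eqF.
Qed.

Lemma col_sqnorm_centering j : \sum_i sqnorm (P i j) = 1 - nR^-1.
Proof.
have cR : sqnorm (n%:R^-1 : C) = nR^-1 ^+ 2 by rewrite -toC_nV sqnorm_real.
rewrite (bigD1 j) //= (eq_bigr (fun=> nR^-1 ^+ 2)); last first.
  move=> i /negPf ij; rewrite !mxE ij mulr0n sub0r -mulN1r sqnormM cR.
  by rewrite -(rmorphN1 toC) sqnorm_real sqrrN expr1n mul1r.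
have -> : P j j = toC (1 - nR^-1).
  by rewrite !mxE eqxx mulr1n rmorphB /= toC_nV rmorph1.
rewrite sqnorm_real sumr_const cardC1 card_ord -[_ *+ n.-1]mulr_natr.
have -> : n.-1%:R = nR - 1 :> R by rewrite -subn1 natrB.
by field; rewrite gt_eqF.
Qed.

Local Notation adj A := (map_mx Num.conj A^T).

Let adjK (m p : nat) (A : 'M[C]_(m, p)) : adj (adj A) = A.
Proof. by apply/matrixP => i j; rewrite !mxE conjCK. Qed.

Let adjM (m p q : nat) (A : 'M[C]_(m, p)) (B : 'M[C]_(p, q)) :
  adj (A *m B) = adj B *m adj A.
Proof. by rewrite trmx_mul map_mxM. Qed.

Let gram_hermsym (m p : nat) (A : 'M[C]_(m, p)) : A *m adj A \is hermsymmx.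
Proof.
apply/is_hermitianmxP; rewrite expr0 scale1r.
by rewrite -[RHS]/(adj (A *m adj A)) adjM adjK.
Qed.

Let centering_adj : adj P = P.
Proof.
apply/matrixP => i j; rewrite !mxE rmorphB rmorph_nat fmorphV rmorph_nat.
by rewrite eq_sym.
Qed.

Let gram_mulmx_centering (A : 'M[C]_n) :
  P *m A = A -> A *m adj A *m P = A *m adj A.
Proof. by move=> PA; rewrite -mulmxA -centering_adj -adjM PA. Qed.

Let mulmx_adj_diag (m p : nat) (A : 'M[C]_(m, p)) k :
  (A *m adj A) k k = toC (\sum_j sqnorm (A k j)).
Proof.
by rewrite mxE rmorph_sum; apply: eq_bigr => j _; rewrite !mxE /= sqnormE.
Qed.

Let unitary_adjK (U : 'M[C]_n) : U \is unitarymx -> adj U *m U = 1%:M.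
Proof. by move/unitarymxP/mulmx1C. Qed.

(** * Schur basis and the resolvent bound, for 1 < q < 2 *)

(** P and M commute, so one unitary [U] makes both triangular. A triangular idempotent has diagonal
    entries 0 or 1, and those of U P adj(U) are the squared row norms of [U *m P]. *)
Lemma schur_compression : exists U : 'M[C]_n,
  [/\ U \is unitarymx,
      forall k, \sum_j sqnorm ((U *m P) k j) = 0 \/
                \sum_j sqnorm ((U *m P) k j) = 1 &
      char_poly M = \prod_k ('X - ((U *m M *m adj U) k k)%:P)].
Proof.
have PP := centering_idem C n.
have PM : P *m M = M *m P.
  by rewrite /compression !mulmxA PP -!mulmxA PP.
have [U Uu /andP[]] := cotrigonalization2 PM.
rewrite /similar_to !conjymx // => tP tM.
have UU := unitary_adjK _ Uu.
exists U; split => // [k|]; last first.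
  rewrite -[LHS](_ : char_poly (U *m M *m adj U) = _); last first.
    by rewrite char_poly_mulmxC mulmxA UU mul1mx.
  exact: char_poly_trig.
have [T TE] : exists T, T = U *m P *m adj U by eexists.
rewrite -TE in tP.
have TT : T *m T = T.
  by rewrite TE !mulmxA -(mulmxA _ _ U) UU mulmx1 -(mulmxA U) PP.
have Tkk : T k k = toC (\sum_j sqnorm ((U *m P) k j)).
  rewrite TE -mulmx_adj_diag adjM centering_adj mulmxA.
  by rewrite -(mulmxA U P P) PP.
have : T k k * T k k = T k k.
  rewrite -[in RHS]TT mxE (bigD1 k) //= big1 ?addr0 // => j jk.
  have /is_trig_mxP trig := tP.
  have [kj|jk'|/val_inj kj] := ltngtP k j.
  - by rewrite trig // mul0r.
  - by rewrite [X in _ * X]trig // mulr0.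
  - by rewrite kj eqxx in jk.
rewrite Tkk -rmorphM => /complexI/eqP; rewrite -[X in _ == X]mulr1 -subr_eq0.
rewrite -mulrBr mulf_eq0 subr_eq0 => /orP[] /eqP; [by left | by right].
Qed.

Let sqnorm_diag_le (U A : 'M[C]_n) k : U \is unitarymx ->
  sqnorm ((A *m adj U) k k) <= \sum_j sqnorm (A k j).
Proof.
move=> Uu; rewrite mxE; apply: le_trans (sqnorm_cauchy_schwarz _ _ _) _.
under [X in _ * X]eq_bigr do rewrite !mxE sqnormC.
by rewrite (row_sqnorm_unitary _ U) // mulr1.
Qed.

(** Since b^2/(b + l) = b - l + l^2/(b + l), an upper bound on 1/(b + l) suffices for each row kept
    by P; the bounds are then summed through traces. *)
Lemma resolvent_compression (U : 'M[C]_n) (l : R)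
    (b := fun k => \sum_j sqnorm ((U *m M) k j)) :
  U \is unitarymx ->
  (forall k, \sum_j sqnorm ((U *m P) k j) = 0 \/
             \sum_j sqnorm ((U *m P) k j) = 1) ->
  0 < l ->
  \sum_k b k ^+ 2 / (b k + l) <=
  (1 - 2 / nR) * \sum_j x j ^+ 2 / (x j + l).
Proof.
move=> Uu Up l0; pose V := U *m P; pose r j := (l + x j)^-1.
pose S := \sum_j r j.
have r0 j : 0 < r j by rewrite invr_gt0 ltr_wpDr ?sqnorm_ge0.
have S0 : 0 < S.
  rewrite /S (bigD1 (Ordinal n_gt0)) //= ltr_wpDr ?r0 //.
  by apply: sumr_ge0 => j _; exact: ltW.
have lS : 0 < l * S by rewrite mulr_gt0.
pose p k := \sum_j sqnorm (V k j).
pose kap k := \sum_j z j * toC (r j) * V k j.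
pose rho k := \sum_j r j * sqnorm (V k j) + sqnorm (kap k) / (l * S).
have b0 k : 0 <= b k by apply: sumr_ge0 => j _; exact: sqnorm_ge0.
(* The factor [p k] drops the term l on rows annihilated by P, where b^2/(b + l) <= b is enough. *)
have bound k : b k ^+ 2 / (b k + l) <= b k - l * p k + l ^+ 2 * rho k.
  have bl : 0 < b k + l by rewrite ltr_wpDl.
  have rho0 : 0 <= rho k.
    apply: addr_ge0; last by rewrite divr_ge0 ?sqnorm_ge0 // ltW.
    by apply: sumr_ge0 => j _; rewrite mulr_ge0 ?sqnorm_ge0 ?ltW.
  have E : b k ^+ 2 / (b k + l) = b k - l + l ^+ 2 / (b k + l).
    by field; rewrite gt_eqF.
  case: (Up k) => pk; rewrite /p pk.
    rewrite mulr0 subr0; apply: ler_wpDr; first by rewrite mulr_ge0 ?sqr_ge0.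
    by rewrite ler_pdivrMr // expr2 ler_wpM2l // lerDl ltW.
  rewrite E mulr1 lerD2l ler_wpM2l ?sqr_ge0 // -[leLHS]div1r ler_pdivrMr //.
  rewrite mulrC.
  (* Taking the mean for c makes the centered vector equal to row k of [U *m M]. *)
  have := resolvent_cauchy_schwarz _ z (V k) ((\sum_j V k j * z j) / n%:R) l l0.
  rewrite -/S gt_eqF // => /(_ isT); rewrite pk expr1n mulr1 -/(rho k).
  suff -> : \sum_j sqnorm (V k j * z j - (\sum_j V k j * z j) / n%:R) = b k.
    by rewrite addrC.
  by apply: eq_bigr => j _; rewrite mulmx_compressionE.
apply: le_trans (ler_sum _ (fun k _ => bound k)) _.
have colV j : \sum_k sqnorm (V k j) = 1 - nR^-1.
  by rewrite sum_sqnorm_unitary_mul // col_sqnorm_centering.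
have sum_b : \sum_k b k = (1 - 2 / nR) * \sum_j x j.
  rewrite -sum_sqnorm_compression exchange_big [RHS]exchange_big /=.
  by apply: eq_bigr => j _; rewrite sum_sqnorm_unitary_mul.
have sum_p : \sum_k p k = nR - 1.
  rewrite exchange_big (eq_bigr (fun=> 1 - nR^-1)) //.
  by rewrite sumr_const card_ord -[_ *+ n]mulr_natr; field; rewrite gt_eqF.
have sum_rV : \sum_k \sum_j r j * sqnorm (V k j) = (1 - nR^-1) * S.
  rewrite exchange_big /S mulr_sumr; apply: eq_bigr => j _.
  by rewrite -mulr_sumr colV mulrC.
(* Pairing [g] with the rows of UP is pairing its centered version with the rows of U; U preserves
   norms and centering does not increase them. *)
have sum_kap : \sum_k sqnorm (kap k) <= \sum_j x j * r j ^+ 2.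
  pose g j := z j * toC (r j).
  have -> : \sum_j x j * r j ^+ 2 = \sum_j sqnorm (g j).
    by apply: eq_bigr => j _; rewrite sqnormM sqnorm_real.
  apply: le_trans (sum_sqnorm_sub_mean _ _ n_gt0).
  rewrite -(sum_sqnorm_unitary _ _ (fun j => g j - (\sum_k g k) / n%:R) Uu).
  rewrite le_eqVlt; apply/orP; left.
  apply/eqP/eq_bigr => k _; congr sqnorm.
  have VE j : V k j = U k j - (\sum_l U k l) / n%:R by exact: mulmx_centeringE.
  transitivity (\sum_j (g j * U k j - g j * ((\sum_l U k l) / n%:R))).
    by apply: eq_bigr => j _; rewrite -mulrBr -VE.
  under [RHS]eq_bigr do rewrite mulrBr.
  rewrite !sumrB; congr (_ - _); first by apply: eq_bigr => j _; rewrite mulrC.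
  by rewrite -!mulr_suml mulrCA.
have sum_r2 : S ^+ 2 <= nR * \sum_j r j ^+ 2.
  rewrite expr2; under [X in _ <= _ * X]eq_bigr do rewrite expr2.
  by apply: chebyshev_sum => i j; rewrite -expr2 sqr_ge0.
have xr j : x j * r j = 1 - l * r j.
  have d0 : l + x j != 0 by rewrite gt_eqF // ltr_wpDr ?sqnorm_ge0.
  by rewrite /r; field.
have phiE j : x j ^+ 2 / (x j + l) = x j - l + l ^+ 2 * r j.
  have d0 : l + x j != 0 by rewrite gt_eqF // ltr_wpDr ?sqnorm_ge0.
  by rewrite /r (addrC (x j)); field.
under [X in _ <= _ * X]eq_bigr do rewrite phiE.
rewrite !big_split /= -!mulr_sumr -/S !sumrN -!mulr_sumr sum_b sum_p.
rewrite big_split /= sum_rV -mulr_suml sumr_const card_ord.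
set K := \sum_(i < n) sqnorm (kap i) in sum_kap *.
(* By [xr], the bound in [sum_kap] equals S - l sum r_j^2, and [sum_r2] bounds the last sum below by
   S^2/n. *)
have K_le : K / (l * S) <= l^-1 - S / nR.
  rewrite ler_pdivrMr //.
  have -> : (l^-1 - S / nR) * (l * S) = S - l * (S ^+ 2 / nR).
    by field; rewrite !gt_eqF.
  apply: le_trans sum_kap _.
  under eq_bigr do rewrite expr2 mulrA xr mulrBl mul1r -mulrA -expr2.
  rewrite sumrB -mulr_sumr -/S lerD2l lerN2 ler_wpM2l ?(ltW l0) //.
  by rewrite ler_pdivrMr // mulrC.
have ll : 0 < l ^+ 2 by rewrite exprn_gt0.
apply: (@le_trans _ _ ((1 - 2 / nR) * (\sum_(j < n) x j) - l * (nR - 1) +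
  l ^+ 2 * ((1 - nR^-1) * S + (l^-1 - S / nR)))).
  by rewrite lerD2l ler_pM2l // lerD2l.
(* Both sides now agree: -l(n - 1) + l = -(1 - 2/n) l n, and l^2 S has coefficient 1 - 2/n. *)
rewrite -[l *+ n]mulr_natr le_eqVlt; apply/orP; left; apply/eqP.
by field; rewrite !gt_eqF.
Qed.

(** * Spectral decomposition of M adj(M), for q >= 2 *)

(** [F] and [a] are the eigenvectors and eigenvalues of H = M adj(M). As HP = H, a row f of [F] with
    nonzero eigenvalue is fixed by P, so its eigenvalue |f D P|^2 is at most |f D|^2. The last two
    clauses expand the quadratic form of H in this basis. *)
Lemma spectral_compression : exists (F : 'M[C]_n) (a : 'I_n -> R),
  [/\ F \is unitarymx, forall k, 0 <= a k,
      forall k, a k <= \sum_j x j * sqnorm (F k j) \/ a k = 0,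
      forall j, \sum_l sqnorm (M j l) = \sum_k a k * sqnorm (F k j) &
      forall (U : 'M[C]_n) k, \sum_j sqnorm ((U *m M) k j) =
        \sum_l a l * sqnorm ((U *m adj F) k l)].
Proof.
pose H := M *m adj M.
have Hherm : H \is hermsymmx by exact: gram_hermsym.
have /orthomx_spectralP := hermitian_normalmx Hherm.
set F := spectralmx H; set d := spectral_diag H => HE.
have Fu : F \is unitarymx by exact: spectral_unitarymx.
have FF : F *m adj F = 1%:M by apply/unitarymxP.
have FF' := unitary_adjK _ Fu.
rewrite invmx_unitary // -[(F ^t*)%sesqui]/(adj F) in HE.
pose a k := \sum_j sqnorm ((F *m M) k j).
have FHE : F *m H = diag_mx d *m F by rewrite HE !mulmxA FF mul1mx.
have dE k : d 0 k = toC (a k).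
  have : (F *m M *m adj (F *m M)) k k = d 0 k.
    rewrite adjM mulmxA -(mulmxA F) -/H FHE -mulmxA FF mulmx1.
    by rewrite mxE eqxx mulr1n.
  by rewrite mulmx_adj_diag => <-.
have quad (U : 'M[C]_n) k : \sum_j sqnorm ((U *m M) k j) =
    \sum_l a l * sqnorm ((U *m adj F) k l).
  apply: complexI; rewrite -mulmx_adj_diag adjM mulmxA.
  rewrite -(mulmxA U) -/H HE !mulmxA.
  rewrite -[_ *m F *m adj U]mulmxA.
  have -> : F *m adj U = adj (U *m adj F) by rewrite adjM adjK.
  rewrite mxE rmorph_sum; apply: eq_bigr => l _.
  rewrite mul_mx_diag [in X in X * _ = _]mxE !mxE /= dE rmorphM /= sqnormE.
  by ring.
exists F, a; split => //.
- by move=> k; apply: sumr_ge0 => j _; exact: sqnorm_ge0.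
- move=> k; have [->|ak] := eqVneq (a k) 0; [by right | left].
  have HP : H *m P = H.
    by apply: gram_mulmx_centering; rewrite /compression !mulmxA centering_idem.
  have FP j : (F *m P) k j = F k j.
    have /matrixP/(_ k j) : diag_mx d *m (F *m P) = diag_mx d *m F.
      by rewrite mulmxA -FHE -mulmxA HP.
    rewrite !mul_diag_mx [in LHS]mxE [in RHS]mxE; apply: mulfI.
    by rewrite dE -(rmorph0 toC) (inj_eq (@complexI R)).
  rewrite /a; under eq_bigr do rewrite mulmx_compressionE.
  apply: le_trans (sum_sqnorm_sub_mean _ _ n_gt0) _.
  under eq_bigr do rewrite FP sqnormM mulrC.
  exact: lexx.
- move=> j; have := quad 1%:M j; rewrite !mul1mx => ->.
  by apply: eq_bigr => k _; rewrite !mxE sqnormC.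
Qed.

Lemma sum_powR_compression (q : R) (U : 'M[C]_n) : 2 <= q ->
  U \is unitarymx ->
  \sum_k (\sum_j sqnorm ((U *m M) k j)) `^ q <=
  (1 - 2 / nR) * \sum_j x j `^ q.
Proof.
move=> q2 Uu; have [F [a [Fu a0 aF aM quad]]] := spectral_compression.
have q0 : 0 < q by rewrite (lt_le_trans _ q2).
pose G := U *m adj F.
have Gu : G \is unitarymx.
  by apply: mul_unitarymx Uu _; rewrite trmxC_unitary.
apply: (@le_trans _ _ (\sum_k a k `^ q)).
  (* The weights [sqnorm (G k l)] are doubly stochastic: unit row sums allow Jensen, unit column
     sums remove the weights after the exchange. *)
  apply: (@le_trans _ _ (\sum_k \sum_l sqnorm (G k l) * a l `^ q)).
    apply: ler_sum => k _; rewrite quad.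
    under eq_bigr do rewrite mulrC.
    apply: jensen_powR => //; first by rewrite (le_trans _ q2) ?ler1n.
      by move=> l; exact: sqnorm_ge0.
    exact: row_sqnorm_unitary.
  rewrite exchange_big le_eqVlt; apply/orP; left; apply/eqP/eq_bigr => l _ /=.
  rewrite -mulr_suml -[RHS]mul1r; congr (_ * _).
  have := row_sqnorm_unitary _ (adj G) l; rewrite trmxC_unitary => /(_ Gu) <-.
  by apply: eq_bigr => k _; rewrite !mxE sqnormC.
have Fk k : \sum_j sqnorm (F k j) = 1 by exact: row_sqnorm_unitary.
apply: (@le_trans _ _ (\sum_k a k * \sum_j sqnorm (F k j) * x j `^ (q - 1))).
  apply: ler_sum => k _; case: (aF k) => [ak|->]; last first.
    by rewrite powR0 ?gt_eqF // mul0r.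
  (* One factor [a k] is split off, and Jensen is applied to the exponent q - 1, which is at least 1
     because q >= 2. *)
  rewrite -(mulr_powRB1 (a0 k) q0) ler_wpM2l //.
  apply: (@le_trans _ _ ((\sum_j sqnorm (F k j) * x j) `^ (q - 1))).
    rewrite ge0_ler_powR ?nnegrE ?subr_ge0 ?(le_trans _ q2) ?ler1n //.
      by apply: sumr_ge0 => j _; rewrite mulr_ge0 ?sqnorm_ge0.
    by under [leRHS]eq_bigr do rewrite mulrC.
  apply: jensen_powR => //.
  - by rewrite lerBrDr.
  - by move=> l; exact: sqnorm_ge0.
  - by move=> l; exact: sqnorm_ge0.
have -> : \sum_k a k * \sum_j sqnorm (F k j) * x j `^ (q - 1) =
    \sum_j x j `^ (q - 1) * (x j * (1 - 3 / nR) + (\sum_l x l) / nR ^+ 2).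
  under eq_bigr do rewrite mulr_sumr.
  rewrite exchange_big; apply: eq_bigr => j _ /=.
  rewrite -row_sqnorm_compression aM mulr_sumr.
  by apply: eq_bigr => k _; rewrite mulrC -mulrA mulrC -mulrA mulrCA.
have xq j : x j * x j `^ (q - 1) = x j `^ q by rewrite mulr_powRB1 ?sqnorm_ge0.
under eq_bigr do rewrite mulrDr mulrA (mulrC (_ `^ _)) xq.
rewrite big_split /= -!mulr_suml.
(* x_j and x_j^(q-1) are similarly ordered; the remaining gap is exactly this Chebyshev deficit
   divided by n^2. *)
have cheb : (\sum_j x j) * (\sum_j x j `^ (q - 1)) <=
    nR * \sum_j x j `^ q.
  under [in leRHS]eq_bigr do rewrite -xq.
  apply: chebyshev_sum => i j.
  have mono (s t : R) : 0 <= s -> s <= t -> s `^ (q - 1) <= t `^ (q - 1).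
    move=> s0 st; apply: ge0_ler_powR; rewrite ?nnegrE //.
      by rewrite subr_ge0 (le_trans _ q2) ?ler1n.
    exact: le_trans st.
  case: (leP (x i) (x j)) => [|/ltW] h.
    by rewrite mulr_le0 // subr_le0 // mono ?sqnorm_ge0.
  by rewrite mulr_ge0 // subr_ge0 // mono ?sqnorm_ge0.
rewrite -subr_ge0.
have -> : (1 - 2 / nR) * (\sum_j x j `^ q) -
  ((\sum_j x j `^ q) * (1 - 3 / nR) +
   (\sum_j x j `^ (q - 1)) * ((\sum_l x l) / nR ^+ 2)) =
  (nR * (\sum_j x j `^ q) - (\sum_j x j) * (\sum_j x j `^ (q - 1)))
   / nR ^+ 2 by field; rewrite gt_eqF.
by rewrite divr_ge0 ?subr_ge0 // exprn_ge0 // ltW.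
Qed.

(** * Eigenvalue estimate and conclusion *)

Lemma sum_powR_eigenvalues (q : R) (v : 'I_n -> C) : 1 <= q -> (1 < n)%N ->
  char_poly M = \prod_k ('X - (v k)%:P) ->
  \sum_k sqnorm (v k) `^ q <= (1 - 2 / nR) * \sum_j x j `^ q.
Proof.
move=> q1 n1 vE; have [U [Uu Up UE]] := schur_compression.
pose u k := (U *m M *m adj U) k k; pose b k := \sum_j sqnorm ((U *m M) k j).
have b0 k : 0 <= b k by apply: sumr_ge0 => j _; exact: sqnorm_ge0.
have -> : \sum_k sqnorm (v k) `^ q = \sum_k sqnorm (u k) `^ q.
  (* The given eigenvalues and the Schur diagonal are roots of the same split polynomial, hence
     equal up to order. *)
  have vu : perm_eq (codom v) (codom u).
    by apply: prod_XsubC_eq; rewrite !big_image -vE UE.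
  transitivity (\sum_(y <- codom v) sqnorm y `^ q); first by rewrite big_image.
  by rewrite (perm_big _ vu) big_image.
apply: (@le_trans _ _ (\sum_k b k `^ q)).
  apply: ler_sum => k _; apply: ge0_ler_powR; rewrite ?nnegrE ?sqnorm_ge0 //.
    exact: le_trans ler01 q1.
  exact: sqnorm_diag_le.
have c0 : 0 <= 1 - 2 / nR.
  by rewrite subr_ge0 ler_pdivrMr // mul1r ler_nat.
move: q1; rewrite le_eqVlt => /predU1P[<-|q1].
  under eq_bigr do rewrite powRr1 //.
  under [in leRHS]eq_bigr do rewrite powRr1 ?sqnorm_ge0 //.
  rewrite -sum_sqnorm_compression exchange_big [leRHS]exchange_big /=.
  by apply: ler_sum => l _; rewrite sum_sqnorm_unitary_mul.
have [q2|q2] := ltP q 2; last exact: sum_powR_compression.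
apply: ler_sum_powR_of_resolvent => //; first by rewrite q1.
  by move=> j; exact: sqnorm_ge0.
by move=> l l0; exact: resolvent_compression.
Qed.

End Compression.

(* Monic p of degree n with zeros z_1..z_n (with multiplicity):
     p = \prod_j ('X - z_j);
   critical points w_1..w_{n-1} (with multiplicity) are the zeros of p',
   i.e. p' = n * \prod_k ('X - w_k) (p' has leading coefficient n). *)
Theorem theorem1p1 (R : realType) (n : nat) (hn : (2 <= n)%N)
    (z : 'I_n -> R[i]) (w : 'I_n.-1 -> R[i])
    (hw : (\prod_(j < n) ('X - (z j)%:P))^`() =
          n%:R *: \prod_(k < n.-1) ('X - (w k)%:P))
    (hsum : \sum_(j < n) z j = 0)
    (p : R) (hp : 2 <= p) :
  \sum_(k < n.-1) (ComplexField.Normc.normc (w k)) `^ p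
    <= (n%:R - 2) / n%:R * \sum_(j < n) (ComplexField.Normc.normc (z j)) `^ p.
Proof.
have normE (y : R[i]) : ComplexField.Normc.normc y `^ p = sqnorm y `^ (p / 2).
  have y0 : 0 <= ComplexField.Normc.normc y by case: y => a b; exact: sqrtr_ge0.
  by rewrite sqnorm.unlock -powR_mulrn // -powRrM mulrC divfK ?pnatr_eq0.
under eq_bigr do rewrite normE.
under [in leRHS]eq_bigr do rewrite normE.
have p1 : 1 <= p / 2 by rewrite ler_pdivlMr // mul1r.
have n0 : (0 < n)%N by exact: ltnW.
have nR : n%:R != 0 :> R by rewrite pnatr_eq0 -lt0n.
have nC : n%:R != 0 :> R[i] by rewrite pnatr_eq0 -lt0n.
have charE : char_poly (compression R[i] n z) =
    'X * \prod_(k < n.-1) ('X - (w k)%:P).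
  apply: (scalerI nC); rewrite char_poly_compression //.
  by rewrite hw -scalerAr.
case: n hn z w hw hsum n0 nR nC charE => // m hn z w hw hsum n0 nR nC charE.
(* The n eigenvalues of M: 0 at index [ord0], from the factor X, followed by the n - 1 critical
   points. *)
pose v (k : 'I_m.+1) : R[i] := oapp w 0 (unlift ord0 k).
have vS k : v (lift ord0 k) = w k by rewrite /v liftK.
have v0 : v ord0 = 0 by rewrite /v unlift_none.
have vE : char_poly (compression R[i] m.+1 z) = \prod_k ('X - (v k)%:P).
  rewrite charE big_ord_recl v0 subr0; congr (_ * _).
  by apply: eq_bigr => k _; rewrite vS.
rewrite mulrBl divff //.
apply: le_trans (sum_powR_eigenvalues _ z n0 hsum (p / 2) v p1 hn vE).
(* The extra eigenvalue contributes nothing since the exponent is nonzero; 0 to the power 0 would be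
   1. *)
rewrite big_ord_recl v0 sqnorm0 powR0; last first.
  by rewrite gt_eqF // (lt_le_trans ltr01).
by rewrite add0r; apply: ler_sum => k _; rewrite vS.
Qed.
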